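(* There exists $\theta_0>0$ such that for every $\theta\in(0,\theta_0]$, every $\theta$-log-convex Stieltjes moment sequence $(\mu_n)_{n\ge0}$ with $\mu_0=1$ and every $t>0$, the Maxwell-Boltzmann sequence $(\mu^{\circ t}_n)_{n\ge0}$ is a Stieltjes moment sequence.
   Context: A sequence of positive real numbers is called a Stieltjes moment sequence if it is the moment sequence of some measure with support in $\mathbf{R}_+$. A sequence $(a_n)_{n\ge0}$ of positive reals is $\theta$-log-convex if $\frac{a_n^2}{a_{n-1}a_{n+1}}\le\theta$ for all $n\ge1$. The Maxwell-Boltzmann $\mu^{\circ t}_n$ is defined for $n\ge1$ by $$\mu^{\circ t}_n=\sum_{j=1}^{n}\binom{t}{j}\sum_{n_1=1}^{n}\cdots\sum_{n_j=1}^{n}\chi_{(n_1+\cdots+n_j=n)}\frac{n!}{n_1!\cdots n_j!}\prod_{i=1}^{j}\mu_{n_i},$$ where $\binom{t}{j}=\frac{t(t-1)\cdots(t-j+1)}{j!}$ and $\chi_{(n_1+\cdots+n_j=n)}$ equals $1$ if $n_1+\cdots+n_j=n$ and $0$ otherwise; and $\mu^{\circ t}_0=1$. *)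

(* Defs.v *)
From mathcomp Require Import all_boot all_order all_algebra.
From mathcomp Require Import all_classical all_reals all_analysis.

Set Implicit Arguments.
Unset Strict Implicit.
Unset Printing Implicit Defensive.

Import Order.TTheory GRing.Theory Num.Theory.
Import numFieldNormedType.Exports.

Local Open Scope classical_set_scope.
Local Open Scope ring_scope.

Definition moment_sequence_of (R : realType)
    (m : {measure set (measurableTypeR R) -> \bar R}) (a : nat -> R) : Prop :=
  forall n : nat,
    m.-integrable setT (fun x : R => (x ^+ n)%:E) /\
    (\int[m]_x (x ^+ n)%:E = (a n)%:E)%E.

(* A Borel measure on R has support in the closed set [0, +oo[ iff it gives
   mass 0 to the complement of that set. *)
Definition stieltjes_moment_sequence (R : realType) (a : nat -> R) : Prop :=
  (forall n : nat, 0 < a n) /\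
  exists m : {measure set (measurableTypeR R) -> \bar R},
    m (~` [set x : R | 0 <= x]) = 0%E /\ moment_sequence_of m a.

Definition theta_log_convex (R : realType) (theta : R) (a : nat -> R) : Prop :=
  (forall n : nat, 0 < a n) /\
  forall n : nat, (1 <= n)%N -> a n ^+ 2 / (a n.-1 * a n.+1) <= theta.

Definition gbinomial (R : realType) (t : R) (j : nat) : R :=
  (\prod_(i < j) (t - i%:R)) / (j`!)%:R.

(* The index f ranges over the j-tuples (n_1, ..., n_j) with 1 <= n_i <= n.
   The general formula would give the empty sum 0 at n = 0, where the value
   is 1 by convention. *)
Definition maxwell_boltzmann (R : realType) (mu : nat -> R) (t : R) (n : nat)
    : R :=
  if n == 0 then 1 else
  \sum_(1 <= j < n.+1) gbinomial t j *
    \sum_(f : {ffun 'I_j -> 'I_n.+1} |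
            [forall i, (1 <= f i)%N] && (\sum_i f i == n)%N)
      (n`!)%:R / (\prod_i ((f i)`!)%:R) * \prod_i mu (f i).

(* Main.v *)
(* Since the exponential generating function of mu^(o t) is that of mu raised to
   the power t, the sequence mu^(o (s + t)) is the binomial convolution of
   mu^(o s) and mu^(o t), i.e. the moment sequence of the convolution of the
   corresponding measures; hence it suffices to treat 0 < t <= 1.  There
   |binom(t, j)| <= t for j >= 1, and strong log-convexity makes the terms j >= 2
   negligible, so mu^(o t)_n is within 8 theta t mu_n of t mu_n and is itself
   strongly log-convex.
   A strongly log-convex sequence a is the moment sequence of an explicit
   discrete measure: with nodes x_k = (a_(k+1) / a_k) / 10 and weights
   u_k a_k / x_k^k the moment equations read (I + E) u = 1, where the entries of
   E are at most 10^(-|n-k|); the Neumann series then gives u >= 0. *)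
Require Import Defs.
From mathcomp Require Import all_boot all_order all_algebra.
From mathcomp Require Import all_classical all_reals all_analysis.
From mathcomp Require Import measurable_realfun ring lra zify.

Import Order.TTheory GRing.Theory Num.Theory.

Local Open Scope classical_set_scope.
Local Open Scope ring_scope.

(** * Discrete measures on the half-line and their convolution *)

(** The underlying measure puts mass [w k] at the point [x k]. Since the terms are nonnegative, the
    sum exists in the extended reals, and its finite value [a n] encodes convergence. *)
Definition discrete_moments {R : realType} (a : nat -> R) : Prop :=
  exists w x : nat -> R, [/\ forall k, 0 <= w k, forall k, 0 <= x k &
    forall n, \esum_(k in [set: nat]) (w k * x k ^+ n)%:E = (a n)%:E].

Lemma discrete_moments_stieltjes {R : realType} (a : nat -> R) :
  (forall n, 0 < a n) -> discrete_moments a -> stieltjes_moment_sequence a.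
Proof.
move=> a0 [w [x [w0 x0 wx]]]; split=> //.
pose m_ k : {measure set (measurableTypeR R) -> \bar R} :=
  mscale (NngNum (w0 k)) (dirac (x k : measurableTypeR R)).
pose m : {measure set (measurableTypeR R) -> \bar R} := mseries m_ 0.
have m_neg : m (~` [set x : R | 0 <= x]) = 0%E.
  rewrite /m /= /mseries eseries0// => k _ _.
  by rewrite /m_/= /mscale/= diracE memNset ?mule0//=; apply.
(* Integration against a series of measures is done for the nonnegative integrand |y|^n. This gives
   integrability at once, and y^n differs from |y|^n only on the null set of negative reals. *)
have m_abs n : (\int[m]_y (`|y| ^+ n)%:E = (a n)%:E)%E.
  have mf : measurable_fun setT (fun y : measurableTypeR R => (`|y| ^+ n : R)%:E).
    by apply/measurable_EFinP; apply: measurable_funX; exact: normr_measurable.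
  rewrite /m ge0_integral_measure_series//.
  rewrite -wx -nneseries_esumT; last by move=> k; rewrite lee_fin mulr_ge0// exprn_ge0.
  apply: eq_eseriesr => k _; rewrite /m_ ge0_integral_mscale//.
  by rewrite integral_dirac//= diracT mul1e ger0_norm.
have mX n : measurable_fun setT (fun y : measurableTypeR R => (y ^+ n : R)%:E).
  by apply/measurable_EFinP; exact: exprn_measurable.
exists m; split=> // n; split.
  apply/integrableP; split => //.
  under eq_integral do rewrite abse_EFin normrX.
  by rewrite m_abs ltry.
rewrite -m_abs; apply: ae_eq_integral => //.
  by apply/measurable_EFinP; apply: measurable_funX; exact: normr_measurable.
exists (~` [set x : R | 0 <= x])%classic; split => //.
  by apply: measurableC; rewrite -set_itvcy; exact: measurable_itv.
by move=> y /=; apply: contra_not => y0 _; rewrite ger0_norm.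
Qed.

Lemma esum_natZl {R : realType} (c : R) (f : nat -> \bar R) :
  0 <= c -> (forall i, (0 <= f i)%E) ->
  (\esum_(i in [set: nat]) (c%:E * f i) = c%:E * \esum_(i in [set: nat]) f i)%E.
Proof.
by move=> c0 f0; rewrite -!nneseries_esumT// ?nneseriesZl// => n; rewrite mule_ge0.
Qed.

(** The convolution has mass w_i v_j at x_i + y_j, with the pairs (i, j) enumerated by a bijection
    [f] from the naturals. The binomial theorem splits each (x_i + y_j)^n into products of a
    function of i and a function of j. *)
Lemma discrete_moments_convolution {R : realType} (a b : nat -> R) :
  discrete_moments a -> discrete_moments b ->
  discrete_moments
    (fun n => \sum_(k < n.+1) (a (n - k)%N * b k) *+ 'C(n, k)).
Proof.
move=> [w [x [w0 x0 wx]]] [v [y [v0 y0 vy]]].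
have /card_esym/ppcard_eqP[f] := card_nat2.
exists (fun k => w (f k).1 * v (f k).2), (fun k => x (f k).1 + y (f k).2).
split=> [k|k|n]; [exact: mulr_ge0|exact: addr_ge0|].
pose G (i j : nat) : R := w i * v j * (x i + y j) ^+ n.
have fbij : set_bij [set: nat] [set: nat * nat] f by [].
rewrite -(@reindex_esum R _ _ _ _ f (fun p => (G p.1 p.2)%:E) fbij).
rewrite [X in \esum_(_ in X) _](_ : _ = [set: nat] `*`` (fun=> [set: nat])); last first.
  by rewrite predeqE.
rewrite -(esum_esum (a := fun i j => (G i j)%:E)); last first.
  by move=> i j _ _; rewrite lee_fin mulr_ge0 ?mulr_ge0 ?exprn_ge0 ?addr_ge0.
pose g k i := w i * x i ^+ (n - k).
pose h (k : nat) j := v j * y j ^+ k.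
have g0 k i : 0 <= g k i by rewrite mulr_ge0 ?exprn_ge0.
have h0 k j : 0 <= h k j by rewrite mulr_ge0 ?exprn_ge0.
have b0 k : 0 <= b k.
  by rewrite -lee_fin -vy; apply: esum_ge0 => j _; rewrite lee_fin h0.
have GE i j : ((G i j)%:E = \sum_(k < n.+1) (g k i *+ 'C(n, k))%:E * (h k j)%:E)%E.
  rewrite /G exprDn mulr_sumr sumEFin; congr EFin; apply: eq_bigr => k _.
  by rewrite /g /h !mulrnAl !mulrnAr; congr (_ *+ _); ring.
under eq_esum => i _.
  under eq_esum => j _ do rewrite GE.
  rewrite esum_sum; last first.
    by move=> j k _ _; rewrite -EFinM lee_fin mulr_ge0 ?mulrn_wge0.
  under eq_bigr => k _.
    rewrite esum_natZl ?mulrn_wge0//; last by move=> j; rewrite lee_fin.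
    rewrite vy muleC.
    over.
  over.
rewrite -sumEFin esum_sum; last first.
  by move=> i k _ _; rewrite -EFinM lee_fin mulr_ge0 ?mulrn_wge0.
apply: eq_bigr => k _.
under eq_esum => i _ do rewrite -EFinM mulrnAr -mulrnAl EFinM.
rewrite esum_natZl ?mulrn_wge0//; last by move=> i; rewrite lee_fin.
by rewrite wx -EFinM mulrnAl mulrC.
Qed.

(** * Nonnegative solutions from the Neumann series *)

Lemma nneseries_le {R : realType} (f : nat -> \bar R) (c : \bar R) :
  (forall k, 0 <= f k)%E -> (forall N, \sum_(0 <= k < N) f k <= c)%E ->
  (\sum_(k <oo) f k <= c)%E.
Proof.
move=> f0 fc; apply: lime_le; last exact: nearW.
by apply: is_cvg_nneseries => n _ _; exact: f0.
Qed.

(** The solution is u = 1 - E 1 + E^2 1 - ... = P - Q. Row sums at most 1/4 give P <= 2, hence Q = E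
    P <= 1/2, whereas P >= 1 from its leading term. *)
Lemma neumann_nonneg {R : realType} (E : nat -> nat -> R) :
  (forall n k, 0 <= E n k) ->
  (forall n, \sum_(k <oo) (E n k)%:E <= (4^-1)%:E)%E ->
  exists u : nat -> R, (forall n, 0 <= u n) /\
    forall n, ((u n)%:E + \sum_(k <oo) (E n k * u k)%:E = 1)%E.
Proof.
move=> E0 E4.
pose T (f : nat -> \bar R) n : \bar R := (\sum_(k <oo) (E n k)%:E * f k)%E.
have T0 f : (forall n, 0 <= f n)%E -> forall n, (0 <= T f n)%E.
  move=> f0 n; apply: nneseries_ge0 => k _ _.
  by rewrite mule_ge0 ?lee_fin.
have Tle f c : (forall n, 0 <= f n)%E -> 0 <= c -> (forall n, f n <= c%:E)%E ->
    forall n, (T f n <= (c / 4)%:E)%E.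
  move=> f0 c0 fc n.
  apply: (@le_trans _ _ (\sum_(k <oo) c%:E * (E n k)%:E)%E).
    apply: lee_nneseries => k _; first by rewrite mule_ge0 ?lee_fin.
    by rewrite muleC lee_wpmul2r ?lee_fin.
  rewrite nneseriesZl//; last by move=> k _; rewrite lee_fin.
  by rewrite EFinM lee_wpmul2l ?lee_fin.
(* [v m] is E^m applied to the constant 1, so it is at most 4^(-m). *)
pose v m : nat -> \bar R := iter m T (fun=> 1%E).
have v0 m : forall n, (0 <= v m n)%E.
  by elim: m => [|m IH] n /=; [exact: lee01 | exact: T0].
have vle m : forall n, (v m n <= (4^-1 ^+ m)%:E)%E.
  elim: m => [|m IH] n; first by rewrite expr0 lexx.
  by rewrite exprSr; apply: Tle => //; exact: exprn_ge0.
(* The even and odd parts of the Neumann series, kept apart so that all sums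
   are of nonnegative extended reals. *)
pose P n : \bar R := (\sum_(m <oo) v m.*2 n)%E.
pose Q n : \bar R := (\sum_(m <oo) v m.*2.+1 n)%E.
have P0 n : (0 <= P n)%E by apply: nneseries_ge0.
have Q0 n : (0 <= Q n)%E by apply: nneseries_ge0.
have TP n : T P n = Q n.
  rewrite /T /P; under eq_eseriesr => k _ do rewrite -nneseriesZl//.
  by rewrite nneseries_interchange// => k m; rewrite mule_ge0 ?lee_fin.
have TQ n : P n = (1 + T Q n)%E.
  rewrite /P nneseries_recl//; congr (_ + _)%E.
  rewrite -nneseries_addn//; under eq_eseriesr => m _ do rewrite addn1.
  rewrite /T /Q; under [RHS]eq_eseriesr => k _ do rewrite -nneseriesZl//.
  by rewrite [RHS]nneseries_interchange// => k m; rewrite mule_ge0 ?lee_fin.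
have P2 n : (P n <= 2%:E)%E.
  apply: nneseries_le => // N.
  apply: (@le_trans _ _ (\sum_(0 <= m < N) (4^-1 ^+ m)%:E)%E).
    apply: lee_sum => m _; rewrite (le_trans (vle _ _))// lee_fin.
    by rewrite ler_wiXn2l -?addnn ?leq_addr//; lra.
  rewrite sumEFin lee_fin.
  suff : \sum_(0 <= m < N) 4^-1 ^+ m <= 2 - 2 * (4^-1 : R) ^+ N.
    by move/le_trans; apply; rewrite gerBl mulr_ge0 ?exprn_ge0.
  elim: N => [|N IH]; first by rewrite big_nil expr0; lra.
  rewrite big_nat_recr//= exprS.
  have : (0 : R) <= 4^-1 ^+ N by rewrite exprn_ge0.
  lra.
have Qle n : (Q n <= (2^-1)%:E)%E.
  rewrite -TP (_ : 2^-1 = 2 / 4); last by lra.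
  exact: Tle.
have [p Pfin] : exists p : nat -> R, forall n, P n = (p n)%:E.
  exists (fine \o P) => n.
  by rewrite /= fineK// ge0_fin_numE// (le_lt_trans (P2 n))// ltry.
have [q Qfin] : exists q : nat -> R, forall n, Q n = (q n)%:E.
  exists (fine \o Q) => n.
  by rewrite /= fineK// ge0_fin_numE// (le_lt_trans (Qle n))// ltry.
have u0 n : 0 <= p n - q n.
  have : q n <= 2^-1 by rewrite -lee_fin -Qfin.
  have : 1 <= p n by rewrite -lee_fin -Pfin TQ leeDl// T0.
  lra.
exists (fun n => p n - q n); split=> // n.
have : (\sum_(k <oo) (E n k * (p k - q k))%:E + T Q n = T P n)%E.
  rewrite /T -nneseriesD; last 2 first.
  - by move=> k _ _; rewrite lee_fin mulr_ge0.
  - by move=> k _ _; rewrite mule_ge0 ?lee_fin.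
  apply: eq_eseriesr => k _.
  rewrite Pfin Qfin -!EFinM -EFinD; congr EFin; ring.
(* With E Q = P - 1 and E P = Q, linearity gives E (P - Q) = Q - P + 1; the case analysis rules out
   an infinite sum. *)
have /(congr1 (fun x => x - 1)%E) := TQ n.
rewrite addeAC subee// add0e TP Qfin Pfin => <-.
rewrite -EFinB; case: (\sum_(k <oo) _)%E => //= r.
rewrite -!EFinD => -[<-]; congr EFin; ring.
Qed.

(** * Representing measures of strongly log-convex sequences *)

Lemma log_convex_discrete_moments {R : realType} (a : nat -> R) :
  (forall n, 0 < a n) ->
  (forall n, 100 * a n.+1 ^+ 2 <= a n * a n.+2) ->
  discrete_moments a.
Proof.
move=> a0 alc.
pose r n := a n.+1 / a n.
have r0 n : 0 < r n by rewrite divr_gt0.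
have r100 n : 100 * r n <= r n.+1.
  rewrite /r mulrA ler_pdivrMr// mulrAC ler_pdivlMr//.
  by have := alc n; rewrite mulrAC expr2; lra.
have rle m n : (m <= n)%N -> r m <= r n.
  move=> mn; apply: (homo_leq (f := r) (r := fun x y : R => x <= y)) mn => //.
    by move=> x y z; exact: le_trans.
  by move=> k; have := r100 k; have := r0 k; lra.
(* Any x_k well between r_(k-1) and r_k makes the moment matrix diagonally
   dominant. *)
pose x k := r k / 10.
have x0 k : 0 < x k by rewrite divr_gt0.
(* The n-th moment equation divided by a_n has these coefficients of u_k; the diagonal is 1. *)
pose A n k := a k / a n * x k ^+ n / x k ^+ k.
have A0 n k : 0 < A n k by rewrite !(divr_gt0, mulr_gt0, exprn_gt0).
have Ann n : A n n = 1.
  by rewrite /A divff ?gt_eqF// mul1r divff// gt_eqF// exprn_gt0.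
have AS n k : A n.+1 k = A n k * (x k / r n).
  rewrite /A /r exprS; field.
  by rewrite !gt_eqF// exprn_gt0.
(* Down column k, consecutive entries have ratio x_k / r_n. It is at most 1/10 from the diagonal on,
   as r_n >= r_k, and at least 10 above it, as r_k >= 100 r_n. *)
have Adown n k : (k <= n)%N -> A n.+1 k <= A n k / 10.
  move=> kn; rewrite AS ler_pM2l// ler_pdivrMr// /x mulrC.
  by have := rle _ _ kn; lra.
have Aup n k : (n < k)%N -> A n k <= A n.+1 k / 10.
  move=> nk; rewrite AS -mulrA ler_peMr ?(ltW (A0 _ _))//.
  case: k nk => // k nk; have := r100 k; have := rle n k nk; rewrite /x => h1 h2.
  by rewrite mulrAC ler_pdivlMr// mul1r; lra.
have Adown' k d : A (k + d)%N k <= 10^-1 ^+ d.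
  elim: d => [|d IH]; first by rewrite addn0 Ann.
  rewrite addnS [leRHS]exprSr; apply: le_trans (Adown _ _ (leq_addr _ _)) _.
  by rewrite ler_pM2r.
have Aup' n d : A n (n + d)%N <= 10^-1 ^+ d.
  elim: d n => [|d IH] n; first by rewrite addn0 Ann.
  apply: le_trans (Aup _ _ _) _; first by rewrite addnS ltnS leq_addr.
  by rewrite [leRHS]exprSr addnS -addSn ler_pM2r.
pose E n k := if k == n then 0 else A n k.
have E0 n k : 0 <= E n k by rewrite /E; case: ifP => // _; exact: ltW.
have E1 n N : (N <= n)%N -> \sum_(0 <= k < N) E n k <= 10^-1 ^+ (n - N) / 9.
  elim: N => [|N IH] Nn; first by rewrite big_nil divr_ge0 ?exprn_ge0.
  rewrite big_nat_recr//= {2}/E ltn_eqF//.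
  have := IH (ltnW Nn); have := Adown' N (n - N)%N.
  rewrite subnKC ?(ltnW Nn)//.
  have -> : (n - N = (n - N.+1).+1)%N by rewrite -subSn.
  by rewrite exprS; lra.
(* Each side of the diagonal contributes at most 1/10 + 1/100 + ... = 1/9, and 2/9 is below the 1/4
   required for the Neumann series. *)
have E2 n d : \sum_(0 <= k < n.+1 + d) E n k <= 2 / 9 - 10^-1 ^+ d / 9.
  elim: d => [|d IH].
    rewrite addn0 big_nat_recr//= {2}/E eqxx addr0 (le_trans (E1 _ _ _))//.
    by rewrite subnn expr0; lra.
  rewrite addnS big_nat_recr//= {2}/E gtn_eqF ?addSn ?ltnS ?leq_addr//.
  have := Aup' n d.+1; rewrite addnS => h; rewrite addSn in IH.
  by move: h; rewrite exprS; lra.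
have E4 n : (\sum_(k <oo) (E n k)%:E <= (4^-1)%:E)%E.
  apply: nneseries_le => [k|N]; first by rewrite lee_fin.
  rewrite sumEFin lee_fin; have [Nn|nN] := leqP N n.
    apply: le_trans (E1 _ _ Nn) _.
    have : 10^-1 ^+ (n - N) <= (1 : R) by rewrite exprn_ile1//; lra.
    by lra.
  rewrite -(subnKC nN); apply: le_trans (E2 _ _) _.
  have : (0 : R) <= 10^-1 ^+ (N - n.+1) by rewrite exprn_ge0.
  by lra.
have [u [u0 uE]] := neumann_nonneg _ E0 E4.
exists (fun k => u k * a k / x k ^+ k), x; split=> [k|k|n].
- by rewrite divr_ge0 ?mulr_ge0 ?exprn_ge0// ltW.
- exact: ltW.
transitivity (\esum_(k in [set: nat]) ((a n)%:E * (A n k * u k)%:E))%E.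
  apply: eq_esum => k _; rewrite -EFinM; congr EFin; rewrite /A.
  by field; rewrite !gt_eqF// exprn_gt0.
have Au0 k : (0 <= (A n k * u k)%:E)%E by rewrite lee_fin mulr_ge0// ltW.
rewrite esum_natZl ?ltW// -nneseries_esumT//.
rewrite (@nneseriesD1 _ _ n)// Ann mul1r.
rewrite eseries_mkcond (eq_eseriesr (g := fun k => (E n k * u k)%:E)); last first.
  by move=> k _; rewrite /E; case: eqP => //= _; rewrite mul0r.
by rewrite uE mule1.
Qed.

(** * Binomial coefficients with real upper argument *)

Lemma gbinomial0 {R : realType} (t : R) : gbinomial t 0 = 1.
Proof. by rewrite /gbinomial big_ord0 fact0 divr1. Qed.

Lemma gbinomialS {R : realType} (t : R) (j : nat) :
  j.+1%:R * gbinomial t j.+1 = (t - j%:R) * gbinomial t j.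
Proof.
rewrite /gbinomial big_ord_recr/= factS natrM.
by field; rewrite nat1r !pnatr_eq0 -lt0n fact_gt0.
Qed.

(** After multiplication by m + 1 = i + (m + 1 - i), each part is absorbed into one of the two
    factors by [gbinomialS], which reduces the identity to the one for m. *)
Lemma gbinomial_vandermonde {R : realType} (s t : R) (m : nat) :
  gbinomial (s + t) m = \sum_(i < m.+1) gbinomial s i * gbinomial t (m - i)%N.
Proof.
elim: m => [|m IH]; first by rewrite big_ord1 !gbinomial0 mulr1.
apply: (@mulfI _ (m.+1%:R : R)); first by rewrite pnatr_eq0.
rewrite gbinomialS {}IH !mulr_sumr.
under [RHS]eq_bigr => i _.
  rewrite (_ : m.+1%:R = i%:R + (m.+1 - i)%N%:R); last first.
    by rewrite -natrD subnKC// -ltnS.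
  rewrite mulrDl; over.
rewrite big_split/= [X in _ = X + _]big_ord_recl mul0r add0r [X in _ = _ + X]big_ord_recr/=.
rewrite subnn mul0r addr0 -big_split/=; apply: eq_bigr => i _.
rewrite /bump/= add1n subSS.
have im : (i <= m)%N by rewrite -ltnS.
have := gbinomialS s i; have := gbinomialS t (m - i).
rewrite subSn// (natrB _ im) => Ht Hs.
by rewrite [X in _ = X + _]mulrA Hs [X in _ = _ + X]mulrCA Ht; ring.
Qed.

(** Passing to the next coefficient multiplies by (t - j - 1) / (j + 2), of modulus at most 1 for
    these t. *)
Lemma normr_gbinomial_le {R : realType} (t : R) (j : nat) :
  0 < t <= 1 -> `|gbinomial t j.+1| <= t.
Proof.
move=> /andP[t0 t1]; elim: j => [|j IH].
  have := gbinomialS t 0; rewrite gbinomial0 mul1r subr0 mulr1 => ->.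
  by rewrite gtr0_norm.
rewrite -(@ler_pM2l _ (j.+2%:R)) ?ltr0n// -[X in X * `|_|]ger0_norm//.
rewrite -normrM gbinomialS normrM; apply: ler_pM => //.
have j0 : (0 : R) <= j%:R by [].
by rewrite ler_norml -!natr1; apply/andP; split; lra.
Qed.

(** * Exponential generating functions and the semigroup law *)

Lemma coef_poly_exp {R : comNzRingType} (c : nat -> R) (n j m : nat) :
  ((\poly_(i < n) c i) ^+ j)`_m =
  \sum_(f : {ffun 'I_j -> 'I_n} | (\sum_i f i == m)%N) \prod_i c (f i).
Proof.
rewrite poly_def -[X in _ ^+ X](card_ord j) -prodr_const.
rewrite (bigA_distr_bigA (fun (_ : 'I_j) (i : 'I_n) => c i *: 'X^i)) coef_sum.
rewrite [RHS]big_mkcond; apply: eq_bigr => f _ /=.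
rewrite scaler_prod -expr_sum coefZ coefXn eq_sym.
by case: eqP => _; rewrite ?mulr1 ?mulr0.
Qed.

(** The exponential generating function, truncated to a polynomial and without its constant term, so
    that its j-th power starts in degree j. *)
Definition egf {R : realType} (mu : nat -> R) (N : nat) : {poly R} :=
  \poly_(i < N.+1) (if i == 0%N then 0 else mu i / i`!%:R).

Lemma coef_egf {R : realType} (mu : nat -> R) (N n : nat) : (n <= N)%N ->
  (egf mu N)`_n = if n == 0%N then 0 else mu n / n`!%:R.
Proof. by move=> nN; rewrite coef_poly ltnS nN. Qed.

Lemma coef_egfX_small {R : realType} (mu : nat -> R) (N j n : nat) :
  (n < j)%N -> (egf mu N ^+ j)`_n = 0.
Proof.
elim: j n => // j IH n nj; rewrite exprS coefM big1// => i _.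
have [->|i0] := posnP i; first by rewrite coef_egf// mul0r.
rewrite IH ?mulr0//; have := ltn_ord i; lia.
Qed.

Lemma eq_coef_egfX {R : realType} (mu : nat -> R) (N M j n : nat) :
  (n <= N)%N -> (n <= M)%N -> (egf mu N ^+ j)`_n = (egf mu M ^+ j)`_n.
Proof.
elim: j n => [|j IH] n nN nM; first by rewrite !expr0.
rewrite !exprS !coefM; apply: eq_bigr => i _.
have ni : (i <= n)%N by rewrite -ltnS.
rewrite !coef_egf ?(leq_trans ni)// IH//; exact: leq_trans (leq_subr _ _) _.
Qed.

Lemma coef_comp_egf {R : realType} (mu : nat -> R) (N n : nat) (p : {poly R}) :
  (p \Po egf mu N)`_n = \sum_(j < n.+1) p`_j * (egf mu N ^+ j)`_n.
Proof.
rewrite coef_comp_poly.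
pose S m := \sum_(j < m) p`_j * (egf mu N ^+ j)`_n.
(* Padding by zero terms compares the sums of length [size p] and n + 1 through their common
   extension. *)
have Smax m k : (forall j, (m <= j)%N -> p`_j * (egf mu N ^+ j)`_n = 0) -> S m = S (m + k)%N.
  move=> z; rewrite /S big_split_ord/= [X in _ = _ + X]big1 ?addr0// => i _.
  by rewrite z// leq_addr.
rewrite -/(S _) -/(S _) (Smax _ n.+1); last first.
  by move=> j pj; rewrite nth_default// mul0r.
rewrite addnC -Smax// => j nj.
by rewrite coef_egfX_small ?mulr0.
Qed.

(** This is n! [z^n] (1 + F(z))^t with F the generating function [egf]; the binomial series may be
    truncated at any N >= n. *)
Lemma maxwell_boltzmannE {R : realType} (mu : nat -> R) (t : R) (N n : nat) :
  (n <= N)%N ->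
  maxwell_boltzmann mu t n =
  n`!%:R * ((\poly_(j < N.+1) gbinomial t j) \Po egf mu N)`_n.
Proof.
move=> nN; rewrite coef_comp_egf /maxwell_boltzmann; case: eqP => [->|/eqP n0].
  by rewrite big_ord1 coef_poly/= gbinomial0 expr0 coef1 fact0 !mulr1.
rewrite -lt0n in n0.
rewrite -(big_mkord xpredT
  (fun j => (\poly_(j < N.+1) gbinomial t j)`_j * (egf mu N ^+ j)`_n)).
rewrite big_ltn// expr0 coef1 gtn_eqF// mulr0 add0r mulr_sumr.
rewrite big_nat_cond [RHS]big_nat_cond; apply: eq_bigr => j /andP[/andP[j0 jn] _].
rewrite coef_poly (leq_trans jn)// mulrCA; congr (_ * _).
rewrite (eq_coef_egfX _ _ n)// /egf coef_poly_exp mulr_sumr.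
(* The restriction n_i >= 1 is enforced by the zero constant term: a tuple with some n_i = 0 has a
   vanishing product. *)
rewrite big_mkcondl/=; apply: eq_bigr => f _; case: forallP => [f1|fN].
  rewrite -mulrA; congr (_ * _); rewrite mulrC -prodf_div/=; apply: eq_bigr => i _.
  by rewrite -[(f i == 0 :> nat)%N]negbK -lt0n f1.
move/forallP: fN => /forallPn[i]; rewrite -leqNgt leqn0 => /eqP fi.
by rewrite (bigD1 i)//= fi eqxx mul0r mulr0.
Qed.

(** The coefficient form of (1 + F)^(s + t) = (1 + F)^s (1 + F)^t. *)
Lemma maxwell_boltzmannD {R : realType} (mu : nat -> R) (s t : R) (n : nat) :
  maxwell_boltzmann mu (s + t) n =
  \sum_(k < n.+1)
    (maxwell_boltzmann mu s (n - k) * maxwell_boltzmann mu t k) *+ 'C(n, k).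
Proof.
pose G t := \poly_(j < n.+1) (gbinomial t j : R).
(* The truncated series for s + t and the product [G s * G t] need only agree up to degree n. *)
have -> : maxwell_boltzmann mu (s + t) n =
    n`!%:R * ((G s * G t) \Po egf mu n)`_n.
  rewrite (maxwell_boltzmannE _ _ _ _ (leqnn n)) !coef_comp_egf; congr (_ * _).
  apply: eq_bigr => m _; congr (_ * _); rewrite coef_poly ltn_ord.
  rewrite gbinomial_vandermonde coefM; apply: eq_bigr => i _.
  rewrite !coef_poly (leq_trans (ltn_ord i))// ltnS.
  by rewrite (leq_trans (leq_subr _ _))// -ltnS.
rewrite comp_polyM coefMr mulr_sumr; apply: eq_bigr => k _.
have kn : (k <= n)%N by rewrite -ltnS.
rewrite (maxwell_boltzmannE _ _ _ _ (leq_subr k n))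
  (maxwell_boltzmannE _ _ _ _ kn).
rewrite -/(G s) -/(G t) -(bin_fact kn) !natrM -mulr_natr; ring.
Qed.

(** * Estimates under strong log-convexity *)

(** Shifting a ratio mu_(n+1) / mu_n by k places gains theta^k; mu_l is a product of l such
    ratios. *)
Lemma log_convex_mul_le {R : realType} (theta : R) (mu : nat -> R) (k l : nat) :
  0 < theta -> theta_log_convex theta mu -> mu 0%N = 1 ->
  mu k * mu l <= theta ^+ (k * l) * mu (k + l)%N.
Proof.
move=> th0 [mu0 lc] mu1.
pose r n := mu n.+1 / mu n.
have r0 n : 0 < r n by rewrite divr_gt0.
have rS n : r n <= theta * r n.+1.
  have := lc n.+1 isT; rewrite ler_pdivrMr ?mulr_gt0//= => h.
  rewrite /r ler_pdivrMr//.
  rewrite (_ : _ * mu n = theta * (mu n * mu n.+2) / mu n.+1); last by ring.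
  by rewrite ler_pdivlMr.
have rD n d : r n <= theta ^+ d * r (d + n)%N.
  elim: d => [|d IH]; first by rewrite mul1r.
  rewrite (le_trans IH)// exprSr -mulrA ler_pM2l ?exprn_gt0//.
have muS n : mu n.+1 = mu n * r n by rewrite /r mulrC divfK// gt_eqF.
elim: l => [|l IH]; first by rewrite muln0 addn0 mu1 mulr1 mul1r.
rewrite addnS !muS mulnS exprD mulrA.
rewrite [leRHS](_ : _ = theta ^+ (k * l) * mu (k + l)%N *
  (theta ^+ k * r (k + l)%N)); last by ring.
by apply: ler_pM => //; [rewrite mulr_ge0 ?(ltW (mu0 _)) | exact: ltW].
Qed.

(** Each further factor of F costs 4 theta: in the binomial convolution theta^(k (n - k)) outweighs
    the total 2^n of the binomial coefficients. *)
Lemma egfX_le {R : realType} (theta : R) (mu : nat -> R) (N j n : nat) :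
  0 < theta -> 2 * theta <= 1 -> theta_log_convex theta mu -> mu 0%N = 1 ->
  (n <= N)%N ->
  0 <= n`!%:R * (egf mu N ^+ j.+1)`_n <= (4 * theta) ^+ j * mu n.
Proof.
move=> th0 th1 lc mu1; have [mu0 _] := lc.
elim: j n => [|j IH] n nN.
  rewrite expr1 expr0 mul1r coef_egf//; case: eqP => [_|_].
    by rewrite mulr0 lexx ltW.
  by rewrite mulrC divfK ?lexx ?andbT ?ltW// pnatr_eq0 -lt0n fact_gt0.
rewrite exprS coefM mulr_sumr.
have term (k : 'I_n.+1) : 0 <= n`!%:R * ((egf mu N)`_k * (egf mu N ^+ j.+1)`_(n - k))
    <= 'C(n, k)%:R * (2^-1 ^+ n * ((4 * theta) ^+ j.+1 * mu n)).
  have kn : (k <= n)%N by rewrite -ltnS.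
  have rhs0 : 0 <= 'C(n, k)%:R * (2^-1 ^+ n * ((4 * theta) ^+ j.+1 * mu n)).
    by rewrite !mulr_ge0 ?exprn_ge0 ?mulr_ge0 ?invr_ge0 ?(ltW th0) ?(ltW (mu0 _)).
  have [k0|k0] := posnP k.
    have Fk : (egf mu N)`_k = 0 by rewrite k0 coef_egf.
    by rewrite Fk mul0r mulr0 lexx.
  have [nk|nk] := leqP n k.
    have -> : (n - k = 0)%N by apply/eqP; rewrite subn_eq0.
    by rewrite coef_egfX_small// !mulr0 lexx rhs0.
  have /andP[l0 lu] := IH (n - k)%N (leq_trans (leq_subr _ _) nN).
  have -> : n`!%:R * ((egf mu N)`_k * (egf mu N ^+ j.+1)`_(n - k)) =
      'C(n, k)%:R * (mu k * ((n - k)`!%:R * (egf mu N ^+ j.+1)`_(n - k))).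
    rewrite coef_egf ?(leq_trans kn)// gtn_eqF// -(bin_fact kn) !natrM; field.
    by rewrite pnatr_eq0 -lt0n fact_gt0.
  apply/andP; split; first by rewrite mulr_ge0// mulr_ge0// ltW.
  rewrite ler_wpM2l//.
  apply: le_trans (ler_wpM2l (ltW (mu0 k)) lu) _.
  rewrite mulrCA.
  rewrite [leRHS](_ : _ = (4 * theta) ^+ j * (2^-1 ^+ n * (4 * theta) * mu n)); last first.
    by rewrite exprS; ring.
  rewrite ler_pM2l ?exprn_gt0 ?mulr_gt0//.
  apply: le_trans (log_convex_mul_le _ _ _ _ th0 lc mu1) _.
  rewrite subnKC// ler_pM2r//.
  (* For 0 < k < n the exponent is smallest at the ends, where it is n - 1; theta <= 1/2 then gives
     theta^(n-1) <= 2^(-n) 4 theta. *)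
  have km : (n.-1 <= k * (n - k))%N by move: k0 nk; clear; nia.
  apply: (@le_trans _ _ (theta ^+ n.-1)).
    by rewrite ler_wiXn2l//; [exact: ltW | lra].
  have key m : theta ^+ m.+1 <= 2^-1 ^+ m.+2 * (4 * theta).
    elim: m => [|m IHm]; first by rewrite expr1 expr2; lra.
    rewrite exprS [in leRHS]exprS -mulrA; apply: ler_pM => //.
    - exact: ltW.
    - by rewrite exprn_ge0// ltW.
    - lra.
  have := key n.-2; have -> : (n.-2.+2 = n)%N by move: k0 nk; clear; lia.
  by have -> : (n.-2.+1 = n.-1)%N by move: k0 nk; clear; lia.
apply/andP; split.
  by apply: sumr_ge0 => k _; have /andP[] := term k.
apply: (@le_trans _ _ (\sum_(k < n.+1) 'C(n, k)%:R *
  (2^-1 ^+ n * ((4 * theta) ^+ j.+1 * mu n)))).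
  by apply: ler_sum => k _; have /andP[] := term k.
rewrite -mulr_suml -natr_sum.
have -> : (\sum_(k < n.+1) 'C(n, k) = 2 ^ n)%N.
  rewrite (expnDn 1 1); apply: eq_bigr => k _.
  by rewrite !exp1n !muln1.
by rewrite natrX mulrA -exprMn divff// expr1n mul1r.
Qed.

Lemma maxwell_boltzmann0 {R : realType} (mu : nat -> R) (t : R) :
  maxwell_boltzmann mu t 0 = 1.
Proof. by []. Qed.

(** The term j = 1 is exactly t mu_n. The others are at most (4 theta)^(j-1) t mu_n, with geometric
    sum at most 8 theta t mu_n because 4 theta <= 1/2. *)
Lemma maxwell_boltzmann_near {R : realType} (theta : R) (mu : nat -> R) (t : R)
    (n : nat) :
  0 < theta -> 8 * theta <= 1 -> theta_log_convex theta mu -> mu 0%N = 1 ->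
  0 < t <= 1 -> (0 < n)%N ->
  `|maxwell_boltzmann mu t n - t * mu n| <= 8 * theta * (t * mu n).
Proof.
move=> th0 th1 lc mu1 /[dup] /andP[t0 t1] t01 n0; have [mu0 _] := lc.
rewrite (maxwell_boltzmannE _ _ _ _ (leqnn n)) coef_comp_egf mulr_sumr.
case: n n0 => // n _; set F := egf mu n.+1.
rewrite 2!big_ord_recl expr0 coef1/= !mulr0 add0r.
have g1 : gbinomial t 1 = t.
  by have := gbinomialS t 0; rewrite gbinomial0 mul1r subr0 mulr1.
rewrite {1}coef_poly/= g1 expr1 coef_egf//=.
have -> : n.+1`!%:R * (t * (mu n.+1 / n.+1`!%:R)) = t * mu n.+1.
  by field; rewrite pnatr_eq0 -lt0n fact_gt0.
rewrite addrAC subrr add0r.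
apply: le_trans (ler_norm_sum _ _ _) _.
apply: (@le_trans _ _ (\sum_(i < n) (4 * theta) ^+ i.+1 * (t * mu n.+1))).
  apply: ler_sum => i _; rewrite /bump/= !add1n.
  have /andP[l u] := egfX_le theta mu n.+1 i.+1 n.+1 th0 ltac:(lra) lc mu1 (leqnn _).
  rewrite coef_poly !ltnS ltn_ord mulrCA normrM (ger0_norm l).
  rewrite [leRHS](_ : _ = t * ((4 * theta) ^+ i.+1 * mu n.+1)); last by ring.
  by apply: ler_pM => //; exact: normr_gbinomial_le.
rewrite -mulr_suml ler_wpM2r ?mulr_ge0 ?(ltW t0) ?(ltW (mu0 _))//.
(* The subtracted remainder is what lets the induction close. *)
suff : \sum_(i < n) (4 * theta) ^+ i.+1 <= 8 * theta - 8 * theta * (4 * theta) ^+ n.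
  move/le_trans; apply; rewrite gerBl !mulr_ge0 ?exprn_ge0 ?mulr_ge0// ltW//.
elim: n {F} => [|n IH]; first by rewrite big_ord0 expr0; lra.
rewrite big_ord_recr/=.
have d0 : 0 <= (4 * theta) ^+ n by rewrite exprn_ge0// mulr_ge0// ltW.
have : (4 * theta) * (4 * theta) ^+ n <= 2^-1 * (4 * theta) ^+ n.
  by rewrite ler_wpM2r//; lra.
rewrite exprS; nra.
Qed.

(** * Times at most 1, and reduction of the general case *)

(** Here 8 theta <= 1/25, so log-convexity survives with constant 200 (24/26)^2 > 100. *)
Lemma maxwell_boltzmann_small_time {R : realType} (theta : R) (mu : nat -> R) (t : R) :
  0 < theta -> theta <= 200^-1 -> theta_log_convex theta mu -> mu 0%N = 1 ->
  0 < t <= 1 ->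
  (forall n, 0 < maxwell_boltzmann mu t n) /\
  discrete_moments (maxwell_boltzmann mu t).
Proof.
move=> th0 th1 lc mu1 t01; have [t0 t1] := andP t01; have [mu0 mulc] := lc.
set a := maxwell_boltzmann mu t.
have near n : 24 / 25 * (t * mu n.+1) <= a n.+1 <= 26 / 25 * (t * mu n.+1).
  have := maxwell_boltzmann_near theta mu t n.+1 th0 ltac:(lra) lc mu1 t01 isT.
  rewrite -/a ler_distl.
  have : 8 * theta * (t * mu n.+1) <= 25^-1 * (t * mu n.+1).
    by rewrite ler_pM2r ?mulr_gt0//; lra.
  by move=> h /andP[h1 h2]; apply/andP; split; lra.
have a0 n : 0 < a n.
  case: n => // n; have /andP[h _] := near n; apply: lt_le_trans h.
  by rewrite !mulr_gt0.
split=> //; apply: log_convex_discrete_moments => // n.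
have lc' : 200 * mu n.+1 ^+ 2 <= mu n * mu n.+2.
  have := mulc n.+1 isT; rewrite ler_pdivrMr ?mulr_gt0//= => h.
  have : theta * (mu n * mu n.+2) <= 200^-1 * (mu n * mu n.+2).
    by rewrite ler_pM2r// mulr_gt0.
  by lra.
have up : a n.+1 ^+ 2 <= (26 / 25) ^+ 2 * (t ^+ 2 * mu n.+1 ^+ 2).
  have /andP[_ h] := near n.
  by rewrite -!exprMn ler_sqr ?nnegrE ?mulr_ge0 ?(ltW t0) ?(ltW (mu0 _)) ?(ltW (a0 _)).
have lo : (24 / 25) ^+ 2 * (t ^+ 2 * (mu n * mu n.+2)) <= a n * a n.+2.
  have /andP[h2 _] := near n.+1.
  (* At n = 0 the value is 1 instead of about t mu_0; t <= 1 makes up for the missing factor t. *)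
  case: n h2 {lc' up} => [|n] h2.
    rewrite mu1 [a 0%N]maxwell_boltzmann0 !mul1r; apply: le_trans h2.
    have : t * (t * mu 2) <= 1 * (t * mu 2) by rewrite ler_pM2r// mulr_gt0.
    have : 0 < t * mu 2 by rewrite mulr_gt0.
    rewrite !expr2; lra.
  have /andP[h1 _] := near n.
  have -> : (24 / 25) ^+ 2 * (t ^+ 2 * (mu n.+1 * mu n.+3)) =
      (24 / 25 * (t * mu n.+1)) * (24 / 25 * (t * mu n.+3)) by ring.
  by apply: ler_pM => //; rewrite !mulr_ge0// ltW.
have : t ^+ 2 * (200 * mu n.+1 ^+ 2) <= t ^+ 2 * (mu n * mu n.+2).
  by rewrite ler_pM2l// exprn_gt0.
have : 0 <= t ^+ 2 * mu n.+1 ^+ 2 by rewrite mulr_ge0// sqr_ge0.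
by lra.
Qed.

Theorem proposition4p22 (R : realType) :
  exists theta0 : R, 0 < theta0 /\
    forall theta : R, 0 < theta -> theta <= theta0 ->
    forall mu : nat -> R,
      theta_log_convex theta mu -> stieltjes_moment_sequence mu -> mu 0%N = 1 ->
    forall t : R, 0 < t ->
      stieltjes_moment_sequence (maxwell_boltzmann mu t).
Proof.
exists 200^-1; split=> [|theta th0 th1 mu lc _ mu1 t t0]; first by rewrite invr_gt0.
(* N exceeds t, so t is a sum of N equal times s <= 1, added one at a time by convolution. *)
pose N := (Num.truncn t).+1.
have N0 : (0 : R) < N%:R by rewrite ltr0n.
pose s := t / N%:R.
have s01 : 0 < s <= 1.
  by rewrite divr_gt0//= ler_pdivrMr// mul1r ltW// truncnS_gt.
have [mb0 mbd] := maxwell_boltzmann_small_time theta mu s th0 th1 lc mu1 s01.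
suff H m : (forall n, 0 < maxwell_boltzmann mu (m.+1%:R * s) n) /\
    discrete_moments (maxwell_boltzmann mu (m.+1%:R * s)).
  have [H0 Hd] := H (Num.truncn t).
  have -> : t = N%:R * s by rewrite mulrC divfK// gt_eqF.
  exact: discrete_moments_stieltjes.
elim: m => [|m [IH0 IHd]]; first by rewrite mul1r.
rewrite -natr1 mulrDl mul1r.
have E : maxwell_boltzmann mu (m.+1%:R * s + s) = fun n => \sum_(k < n.+1)
    (maxwell_boltzmann mu (m.+1%:R * s) (n - k) * maxwell_boltzmann mu s k) *+ 'C(n, k).
  by apply/funext => n; exact: maxwell_boltzmannD.
split=> [n|]; rewrite E; last exact: discrete_moments_convolution.
rewrite big_ord_recl ltr_pwDl//; first by rewrite bin0 mulr_gt0.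
by apply: sumr_ge0 => k _; rewrite mulrn_wge0// mulr_ge0// ltW.
Qed.
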